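(* Let $n\ge 0$ be an integer and let $\Phi_B(t)=(B_{0,n}(t),B_{1,n}(t),\ldots,B_{n,n}(t))^T$, where $B_{i,n}(t)=\frac{n!}{i!(n-i)!}t^i(1-t)^{n-i}$, $i=0,1,\ldots,n$, are the Bernstein basis functions. Let $a\neq b$ be real numbers. Then, for all real $t$, $$\Phi_B((1-t)a+tb)=C_B\,\Phi_B(t),$$ where $C_B=(c_{kl})_{0\le k,l\le n}$ is the $(n+1)\times(n+1)$ matrix whose entry in row $k$ and column $l$ (both indexed from $0$) is $$c_{kl}=\sum_{\substack{i+j=k\\ 0\le i\le l,\;0\le j\le n-l}} B_{i,l}(b)\,B_{j,n-l}(a),\qquad 0\le k,l\le n.$$
   Context: For integers $0\le i\le m$, $B_{i,m}(t)=\frac{m!}{i!(m-i)!}t^i(1-t)^{m-i}$ is the Bernstein polynomial of degree $m$, viewed as a polynomial in $t\in\mathbb{R}$; in particular $B_{0,0}(t)=1$. The sum defining $c_{kl}$ runs over all pairs of integers $(i,j)$ satisfying the displayed conditions. *)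

(* Defs.v *)
From mathcomp Require Import all_boot all_order all_algebra reals.

Set Implicit Arguments.
Unset Strict Implicit.
Unset Printing Implicit Defensive.

Import GRing.Theory Num.Theory.
Local Open Scope ring_scope.

(* Meaningful only for i <= m: since [m - i] is truncated, other values of [i]
   give a nonzero junk polynomial. *)
Definition bernstein (R : realType) (i m : nat) : {poly R} :=
  (m`!%:R / (i`!%:R * (m - i)`!%:R)) *: ('X^i * (1 - 'X) ^+ (m - i)).

Definition bernstein_vec (R : realType) (n : nat) (t : R) : 'cV[R]_n.+1 :=
  \col_(i < n.+1) (bernstein R i n).[t].

(* The pair p = (i, j) ranges over 0 <= i <= l, 0 <= j <= n - l;
   [n - l] is a genuine subtraction since l <= n. *)
Definition bernstein_mx (R : realType) (n : nat) (a b : R) : 'M[R]_n.+1 :=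
  \matrix_(k < n.+1, l < n.+1)
    \sum_(p : 'I_l.+1 * 'I_(n - l).+1 | (p.1 + p.2 == k)%N)
      (bernstein R p.1 l).[b] * (bernstein R p.2 (n - l)).[a].

(* Main.v *)
(** The generating function of the Bernstein polynomials of degree [m] at [s]
    is [(1 - s + s X)^m].  Since [1 - s + s X] is affine in [s], at
    [s = (1 - t) a + t b] it equals
    [(1 - t) (1 - a + a X) + t (1 - b + b X)]; expand the [n]-th power of this
    by the binomial theorem and compare the coefficients of [X^k]. *)
Require Import Defs.
From mathcomp Require Import all_boot all_order all_algebra reals.
From mathcomp Require Import ring.
Import GRing.Theory Num.Theory.
Local Open Scope ring_scope.

(** The factorial quotient is ['C(m, i)] only for [i <= m], as [m - i] truncates. *)
Lemma horner_bernstein (R : realType) (i m : nat) (s : R) : (i <= m)%N ->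
  (bernstein R i m).[s] = 'C(m, i)%:R * (s ^+ i * (1 - s) ^+ (m - i)).
Proof.
move=> le_im; rewrite /bernstein !hornerE; congr (_ * _).
have fact_neq0 k : k`!%:R != 0 :> R by rewrite pnatr_eq0 -lt0n fact_gt0.
by rewrite -natrM -(bin_fact le_im) natrM mulfK // natrM mulf_neq0.
Qed.

Lemma bernstein_genfun (R : realType) (m : nat) (s : R) :
  ((1 - s)%:P + s *: 'X) ^+ m =
  \sum_(i < m.+1) (bernstein R i m).[s] *: 'X^i.
Proof.
rewrite exprDn; apply: eq_bigr => i _.
rewrite horner_bernstein -1?ltnS // exprZn -polyC_exp mul_polyC scalerA.
by rewrite -scaler_nat scalerA (mulrC (s ^+ i)).
Qed.

(** Cauchy product, indexed by pairs so that the entries of [bernstein_mx] appear verbatim. *)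
Lemma coef_sumXnM (R : comNzRingType) (p q k : nat) (u v : nat -> R) :
  ((\sum_(i < p) u i *: 'X^i) * (\sum_(j < q) v j *: 'X^j))`_k =
  \sum_(ij : 'I_p * 'I_q | (ij.1 + ij.2 == k)%N) u ij.1 * v ij.2.
Proof.
rewrite big_distrlr /= pair_big /= coef_sum [RHS]big_mkcond /=.
apply: eq_bigr => -[i j] _ /=.
rewrite -scalerAl -scalerAr -exprD !coefZ coefXn eq_sym.
by case: eqP => _; rewrite ?mulr1 ?mulr0.
Qed.

Theorem proposition2p6 (R : realType) (n : nat) (a b : R) (hab : a <> b) (t : R) :
  bernstein_vec n ((1 - t) * a + t * b) = bernstein_mx n a b *m bernstein_vec n t.
Proof.
apply/colP => k; rewrite !mxE; set s := _ + t * b.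
have -> : (bernstein R k n).[s] = (((1 - s)%:P + s *: 'X) ^+ n)`_k.
  rewrite bernstein_genfun -(poly_def _ (fun i => (bernstein R i n).[s])).
  by rewrite coef_poly ltn_ord.
have -> : (1 - s)%:P + s *: 'X =
    (1 - t) *: ((1 - a)%:P + a *: 'X) + t *: ((1 - b)%:P + b *: 'X) :> {poly R}.
  by rewrite /s -!mul_polyC !(polyCB, polyCD, polyCM, polyC1); ring.
(* The binomial index [l] is also the summation index of the matrix product, so the sums agree term
   by term. *)
rewrite exprDn coef_sum; apply: eq_bigr => l _.
rewrite !mxE -(coef_sumXnM _ _ _ _ (fun i => (bernstein R i l).[b])
  (fun j => (bernstein R j (n - l)).[a])) -!bernstein_genfun.
rewrite horner_bernstein -1?ltnS //.
rewrite !exprZn -scalerAl -scalerAr scalerA coefMn coefZ -mulr_natl.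
(* The expansion puts the power at [a] first, [bernstein_mx] the one at [b]. *)
by rewrite (mulrC (((1 - a)%:P + _) ^+ _)); ring.
Qed.
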